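(* Let $k$ be a commutative ring, $(\mathcal{O},\mu)$ an operad with multiplication in $k$-modules and $\mathcal{M}$ a cyclic unital comp module over $\mathcal{O}$. Then $(\mathcal{M}_{-\bullet},b,\frown)$ is a left dg module over the differential graded associative algebra $(\mathcal{O}^\bullet,\delta,\smile)$; that is, for $\varphi\in\mathcal{O}(p)$ and $\psi\in\mathcal{O}(q)$, $$\iota_\varphi\,\iota_\psi=\iota_{\varphi\smile\psi},\qquad [b,\iota_\varphi]:=b\,\iota_\varphi-(-1)^p\,\iota_\varphi\,b=\iota_{\delta\varphi},$$ where $\iota_\varphi=\varphi\frown(\cdot)$.
   Context: Unadorned tensor products are over $k$. Operad with multiplication. An operad (non-$\Sigma$, in $k$-modules) is a sequence $\{\mathcal{O}(n)\}_{n\ge0}$ of $k$-modules with $k$-bilinear operations $\circ_i:\mathcal{O}(p)\otimes\mathcal{O}(q)\to\mathcal{O}(p+q-1)$ and an identity $\mathbb{1}\in\mathcal{O}(1)$ such that for $\varphi\in\mathcal{O}(p)$, $\psi\in\mathcal{O}(q)$, $\chi\in\mathcal{O}(r)$: $\varphi\circ_i\psi=0$ if $p<i$ or $p=0$; $$(\varphi\circ_i\psi)\circ_j\chi=\begin{cases}(\varphi\circ_j\chi)\circ_{i+r-1}\psi & j<i,\\ \varphi\circ_i(\psi\circ_{j-i+1}\chi) & i\le j<q+i,\\ (\varphi\circ_{j-q+1}\chi)\circ_i\psi & j\ge q+i;\end{cases}$$ and $\varphi\circ_i\mathbb{1}=\mathbb{1}\circ_1\varphi=\varphi$ for $i\le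 p$. It is an operad with multiplication if there are $\mu\in\mathcal{O}(2)$ and $e\in\mathcal{O}(0)$ (the unit) with $\mu\circ_1\mu=\mu\circ_2\mu$ and $\mu\circ_1e=\mu\circ_2e=\mathbb{1}$. Cyclic unital comp module over $\mathcal{O}$. This is a sequence $\{\mathcal{M}(n)\}_{n\ge0}$ of $k$-modules with $k$-linear maps $\bullet_i:\mathcal{O}(p)\otimes\mathcal{M}(n)\to\mathcal{M}(n-p+1)$, defined for $1\le i\le n-p+1$ when $0\le p\le n$ (declared zero if $p>n$), and for $i=0$ when $0\le p\le n+1$ (declared zero if $p>n+1$), together with $k$-linear maps $t:\mathcal{M}(n)\to\mathcal{M}(n)$ (with $t=\mathrm{id}$ on $\mathcal{M}(0)$), such that for $\varphi\in\mathcal{O}(p)$, $\psi\in\mathcal{O}(q)$, $x\in\mathcal{M}(n)$ and all indices $i,j\geq 0$ for which the operations are defined: if $p>0$, $$\varphi\bullet_i(\psi\bullet_jx)=\begin{cases}\psi\bullet_j(\varphi\bullet_{i+q-1}x)& j<i,\\ (\varphi\circ_{j-i+1}\psi)\bullet_ix& j-p<i\le j,\\ \psi\bullet_{j-p+1}(\varphi\bullet_ix)& 0\le i\le j-p;\end{cases}$$ if $p=0$, $$\varphi\bullet_i(\psi\bullet_jx)=\begin{cases}\psi\bullet_j(\varphi\bullet_{i+q-1}x)& j<i,\\ \psi\bullet_{j+1}(\varphi\bullet_ix)& 0\le i\le j;\end{cases}$$ $\mathbb{1}\bullet_ix=x$ for $i=0,\dots,n$; $\ t(\varphi\bullet_ix)=\varphi\bullet_{i+1}t(x)$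 for $i=0,\dots,n-p$; and $t^{n+1}=\mathrm{id}$ on $\mathcal{M}(n)$. Structure on $\mathcal{O}^\bullet$, $\mathcal{O}^n:=\mathcal{O}(n)$. For $\varphi\in\mathcal{O}(p)$, $\psi\in\mathcal{O}(q)$ put $\varphi\,\bar\circ\,\psi:=\sum_{i=1}^p(-1)^{(q-1)(i-1)}\varphi\circ_i\psi$, $\{\varphi,\psi\}:=\varphi\,\bar\circ\,\psi-(-1)^{(p-1)(q-1)}\psi\,\bar\circ\,\varphi$, $\varphi\smile\psi:=(\mu\circ_2\varphi)\circ_1\psi\in\mathcal{O}(p+q)$, and $\delta\varphi:=\{\mu,\varphi\}\in\mathcal{O}(p+1)$. It is well known that $(\mathcal{O}^\bullet,\delta,\smile)$ is a differential graded associative algebra. Structure on $\mathcal{M}_\bullet$, $\mathcal{M}_n:=\mathcal{M}(n)$. The boundary $b:\mathcal{M}_n\to\mathcal{M}_{n-1}$ is $b(x)=\sum_{i=0}^{n-1}(-1)^i\mu\bullet_ix+(-1)^n\mu\bullet_0t(x)$ (and $b=0$ on $\mathcal{M}_0$). The cap product of $\varphi\in\mathcal{O}(p)$ with $x\in\mathcal{M}(n)$ is $\iota_\varphi x:=\varphi\frown x:=(\mu\circ_2\varphi)\bullet_0x\in\mathcal{M}(n-p)$. $\mathcal{M}_{-\bullet}$ denotes $\mathcal{M}$ placed in negative degrees. *)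

(* Defs.v *)
From mathcomp Require Import all_boot all_algebra.

Set Implicit Arguments.
Unset Strict Implicit.
Unset Printing Implicit Defensive.

Import GRing.Theory.
Local Open Scope ring_scope.

(* MathComp, over a possibly trivial commutative ring.                        *)
(*                                                                            *)
(* Arities are natural numbers. An operation whose result has arity           *)
(* p + q - 1 or n - p + 1 takes that arity r (resp. m) as an argument, with a *)
(* proof of r + 1 = p + q (resp. m + p = n + 1). No cast is then needed to    *)
(* compare composites whose arities are equal but not convertible, and        *)
(* nothing happens when the arity would be negative: there the target module  *)
(* is zero.                                                                   *)

(* k-linear in each variable; the library's bilinear_for wants 1 != 0 in k.   *)
Definition kbilinear (k : comPzRingType) (U V W : lmodType k)
    (f : U -> V -> W) : Prop :=
  (forall v : V, linear (f^~ v)) /\ (forall u : U, linear (f u)).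

(* circ _ i f g is the partial composition of f and g at i, where i >= 1.     *)
Record operad (k : comPzRingType) := Operad {
  op_mod :> nat -> lmodType k;
  circ : forall p q r : nat, r.+1 = (p + q)%N ->
    nat -> op_mod p -> op_mod q -> op_mod r;
  op_id : op_mod 1%N;
  circ_bilinear : forall p q r (e : r.+1 = (p + q)%N) i, kbilinear (circ e i);
  circ_eq0 : forall p q r (e : r.+1 = (p + q)%N) i f g,
    (p < i)%N \/ p = 0%N -> circ e i f g = 0;
  circA_lt : forall p q r a b s
      (ea : a.+1 = (p + q)%N) (es : s.+1 = (a + r)%N)
      (eb : b.+1 = (p + r)%N) (es' : s.+1 = (b + q)%N) i j f g h,
    (1 <= i)%N -> (1 <= j)%N -> (j < i)%N ->
    circ es j (circ ea i f g) h = circ es' (i + r - 1) (circ eb j f h) g;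
  circA_mid : forall p q r a b s
      (ea : a.+1 = (p + q)%N) (es : s.+1 = (a + r)%N)
      (eb : b.+1 = (q + r)%N) (es' : s.+1 = (p + b)%N) i j f g h,
    (1 <= i)%N -> (i <= j)%N -> (j < q + i)%N ->
    circ es j (circ ea i f g) h = circ es' i f (circ eb (j - i + 1) g h);
  circA_ge : forall p q r a b s
      (ea : a.+1 = (p + q)%N) (es : s.+1 = (a + r)%N)
      (eb : b.+1 = (p + r)%N) (es' : s.+1 = (b + q)%N) i j f g h,
    (1 <= i)%N -> (q + i <= j)%N ->
    circ es j (circ ea i f g) h = circ es' i (circ eb (j - q + 1) f h) g;
  circ_idr : forall p (e : p.+1 = (p + 1)%N) i f,
    (1 <= i)%N -> (i <= p)%N -> circ e i f op_id = f;
  circ_idl : forall p (e : p.+1 = (1 + p)%N) f, circ e 1 op_id f = f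
}.

Record mult_operad (k : comPzRingType) := MultOperad {
  mo_operad :> operad k;
  mu : mo_operad 2%N;
  munit : mo_operad 0%N;
  muA : circ (erefl : 4%N = (2 + 2)%N) 1 mu mu
        = circ (erefl : 4%N = (2 + 2)%N) 2 mu mu;
  mu_unitl : circ (erefl : 2%N = (2 + 0)%N) 1 mu munit = op_id mo_operad;
  mu_unitr : circ (erefl : 2%N = (2 + 0)%N) 2 mu munit = op_id mo_operad
}.

(* bul _ i f x has indices 0 <= i <= n - p + 1, which is i <= m. When p = 0   *)
(* the paper's two-case relation is bul_lt and bul_ge, as bul_mid is empty.   *)
Record cyclic_comp_module (k : comPzRingType) (O : operad k) := CyclicCompModule {
  cm_mod :> nat -> lmodType k;
  bul : forall p n m : nat, (m + p)%N = n.+1 ->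
    nat -> O p -> cm_mod n -> cm_mod m;
  cyc : forall n, {linear cm_mod n -> cm_mod n};
  bul_bilinear : forall p n m (e : (m + p)%N = n.+1) i, kbilinear (bul e i);
  bul_eq0 : forall p n m (e : (m + p)%N = n.+1) i f x,
    (1 <= i)%N -> (n < p)%N -> bul e i f x = 0;
  bul_lt : forall p q n a b m
      (ea : (a + q)%N = n.+1) (em : (m + p)%N = a.+1)
      (eb : (b + p)%N = n.+1) (em' : (m + q)%N = b.+1) i j f g x,
    (i <= m)%N -> (j <= a)%N -> (j < i)%N ->
    bul em i f (bul ea j g x) = bul em' j g (bul eb (i + q - 1) f x);
  bul_mid : forall p q n a r m
      (ea : (a + q)%N = n.+1) (em : (m + p)%N = a.+1)
      (er : r.+1 = (p + q)%N) (em' : (m + r)%N = n.+1) i j f g x,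
    (i <= m)%N -> (j <= a)%N -> (j < i + p)%N -> (i <= j)%N ->
    bul em i f (bul ea j g x) = bul em' i (circ er (j - i + 1) f g) x;
  bul_ge : forall p q n a b m
      (ea : (a + q)%N = n.+1) (em : (m + p)%N = a.+1)
      (eb : (b + p)%N = n.+1) (em' : (m + q)%N = b.+1) i j f g x,
    (i <= m)%N -> (j <= a)%N -> (i + p <= j)%N ->
    bul em i f (bul ea j g x) = bul em' (j - p + 1) g (bul eb i f x);
  bul_id : forall n (e : (n + 1)%N = n.+1) i x,
    (i <= n)%N -> bul e i (op_id O) x = x;
  cyc0 : forall x : cm_mod 0%N, cyc 0%N x = x;
  cyc_bul : forall p n m (e : (m + p)%N = n.+1) i f x,
    (i + p <= n)%N -> cyc m (bul e i f x) = bul e i.+1 f (cyc n x);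
  cyc_order : forall n x, iter n.+1 (cyc n) x = x
}.

Section CochainOperations.
Variables (k : comPzRingType) (O : mult_operad k).

(* In the signs q.+1 stands for q - 1: same parity, correct for q = 0.        *)
Definition circbar p q r (e : r.+1 = (p + q)%N) (f : O p) (g : O q) : O r :=
  \sum_(1 <= i < p.+1) (-1) ^+ (q.+1 * (i - 1)) *: circ e i f g.

Definition bracket p q r (e : r.+1 = (p + q)%N) (f : O p) (g : O q) : O r :=
  circbar e f g
  - (-1) ^+ (p.+1 * q.+1) *: circbar (etrans e (addnC p q)) g f.

Definition delta p (f : O p) : O p.+1 :=
  bracket (erefl : p.+2 = (2 + p)%N) (mu O) f.

Definition mu2 p (f : O p) : O p.+1 :=
  circ (erefl : p.+2 = (2 + p)%N) 2 (mu O) f.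

Definition cup p q (f : O p) (g : O q) : O (p + q)%N :=
  circ (erefl : (p + q).+1 = (p.+1 + q)%N) 1 (mu2 f) g.

End CochainOperations.

Lemma cap_arity m p n : (m + p)%N = n -> (m + p.+1)%N = n.+1.
Proof. by move=> <-; rewrite addnS. Qed.

Section ChainOperations.
Variables (k : comPzRingType) (O : mult_operad k) (M : cyclic_comp_module O).

(* The boundary on M (n + 1); it is zero on M 0.                              *)
Definition bdry n (x : M n.+1) : M n :=
  \sum_(0 <= i < n.+1) (-1) ^+ i *: bul (addn2 n) i (mu O) x
  + (-1) ^+ n.+1 *: bul (addn2 n) 0 (mu O) (cyc M n.+1 x).

(* cap e f is iota_f : M n -> M (n - p).                                      *)
Definition cap p n m (e : (m + p)%N = n) (f : O p) (x : M n) : M m :=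
  bul (cap_arity e) 0 (mu2 f) x.

End ChainOperations.

(* (M_{-n}, d, act) is a left dg module over (A^p, dA, mul), M n sitting in   *)
(* degree -n and A p in degree p. The components of the identities that are   *)
(* not listed take values in a module of negative index, which is zero.       *)
Record left_dg_module (k : comPzRingType) (A : nat -> lmodType k)
    (dA : forall p, A p -> A p.+1)
    (mul : forall p q, A p -> A q -> A (p + q)%N)
    (M : nat -> lmodType k) (d : forall n, M n.+1 -> M n)
    (act : forall p n m, (m + p)%N = n -> A p -> M n -> M m) : Prop := {
  ldg_d_linear : forall n, linear (d n);
  ldg_dd : forall n (x : M n.+2), d n (d n.+1 x) = 0;
  ldg_act_bilinear : forall p n m (e : (m + p)%N = n), kbilinear (act p n m e);
  ldg_actA : forall p q n a m (eq : (a + q)%N = n) (ep : (m + p)%N = a)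
      (epq : (m + (p + q))%N = n) (f : A p) (g : A q) (x : M n),
    act p a m ep f (act q n a eq g x) = act (p + q)%N n m epq (mul p q f g) x;
  ldg_leibniz : forall p n m (e : (m.+1 + p)%N = n.+1) (e' : (m + p)%N = n)
      (e1 : (m + p.+1)%N = n.+1) (f : A p) (x : M n.+1),
    d m (act p n.+1 m.+1 e f x) - (-1) ^+ p *: act p n m e' f (d n x)
    = act p.+1 n.+1 m e1 (dA p f) x
}.

(* Main.v *)
Require Import Defs.
From HB Require Import structures.
From mathcomp Require Import all_boot all_algebra.
From mathcomp Require Import zify.

(* The boundary b is the alternating sum of the operators mu •_i and of
   mu •_0 t, which satisfy the simplicial identities, so b b = 0. Pairing the
   terms of b iota_f with those of iota_f b, everything cancels except
   mu •_0 iota_f and the terms f' •_0 (mu •_i x) with i <= p, where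
   f' = mu o_2 f; associativity of mu identifies what remains with
   mu o_2 (delta f). *)

Set Implicit Arguments.
Unset Strict Implicit.
Unset Printing Implicit Defensive.

Import GRing.Theory.
Local Open Scope ring_scope.

(** Bundles a bare proof of linearity, so that [linear_sum] and [linearZ] apply to an operation with
    one argument fixed. *)
Lemma linear_packP (k : comPzRingType) (U V : lmodType k) (f : U -> V) :
  linear f -> exists g : {linear U -> V}, f = g.
Proof.
move=> lin_f.
pose g : {linear U -> V} := HB.pack f (GRing.isLinear.Build k U V *:%R f lin_f).
by exists g.
Qed.

(** Induction on [N]: raising [N] by one adds the column [j = N.+1] and the row [i = N]. The
    hypothesis pairs [F i N.+1] with [F N i], and their signs are opposite. *)
Lemma alternating_double_sum (k : comPzRingType) (V : lmodType k)
    (F : nat -> nat -> V) N :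
    (forall i j, (i < j)%N -> (j <= N)%N -> F i j = F j.-1 i) ->
  \sum_(0 <= i < N) (-1) ^+ i *: \sum_(0 <= j < N.+1) (-1) ^+ j *: F i j = 0.
Proof.
elim: N => [|N IHN] FE; first by rewrite big_geq.
rewrite big_nat_recr //=.
have -> : \sum_(0 <= i < N) (-1) ^+ i *:
      \sum_(0 <= j < N.+2) (-1) ^+ j *: F i j
    = \sum_(0 <= i < N) ((-1) ^+ i *: \sum_(0 <= j < N.+1) (-1) ^+ j *: F i j
        + (-1) ^+ i *: ((-1) ^+ N.+1 *: F i N.+1)).
  by apply: eq_bigr => i _; rewrite [X in _ *: X]big_nat_recr //= scalerDr.
rewrite big_split /= IHN ?add0r; last by move=> i j ij jN; apply: FE => //; lia.
rewrite [X in _ *: X]big_nat_recr //= scalerDr addrCA.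
have -> : \sum_(0 <= i < N) (-1) ^+ i *: ((-1) ^+ N.+1 *: F i N.+1)
    + (-1) ^+ N *: ((-1) ^+ N.+1 *: F N N.+1)
    = \sum_(0 <= i < N.+1) (-1) ^+ i *: ((-1) ^+ N.+1 *: F i N.+1).
  by rewrite big_nat_recr.
rewrite scaler_sumr -big_split /= big_nat big1 // => i /andP[_ iN].
by rewrite (FE i N.+1) //= !scalerA -!exprD addnS exprSr mulrN1 scaleNr
           addnC subrr.
Qed.

Section OperadIdentities.
Variables (k : comPzRingType) (O : mult_operad k).

Lemma mu2_linear p : linear (@mu2 k O p).
Proof. exact: ((circ_bilinear O (erefl : p.+2 = (2 + p)%N) 2).2 (mu O)). Qed.

(** Both sides are the triple product with [f] in its third slot. *)
Lemma mu2_circ_mu1 p r (er : r.+1 = (p.+1 + 2)%N) (er' : r.+1 = (2 + p.+1)%N)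
    (f : O p) :
  circ er 1 (mu2 f) (mu O) = circ er' 2 (mu O) (mu2 f).
Proof.
have e : r.+1 = (3 + p)%N by rewrite er' addnS.
rewrite /mu2 (circA_lt _ _ (erefl : 4%N = (2 + 2)%N) e) //= muA.
by rewrite (circA_mid _ _ (erefl : p.+2 = (2 + p)%N) er').
Qed.

(** Both sides are the triple product with [f] in its middle slot. *)
Lemma mu_circ1_mu2 p (er : p.+3 = (2 + p.+1)%N) (f : O p) :
  circ er 1 (mu O) (mu2 f)
  = mu2 (circ (erefl : p.+2 = (2 + p)%N) 1 (mu O) f).
Proof.
have e : p.+3 = (3 + p)%N by [].
rewrite /mu2 -(circA_mid (erefl : 4%N = (2 + 2)%N) e _ _ (j := 2)) // muA.
by rewrite (circA_mid _ _ (erefl : p.+2 = (2 + p)%N)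
                          (erefl : p.+3 = (2 + p.+1)%N)).
Qed.

Lemma mu2_circ p q r (er : r.+1 = (p + q)%N) (er' : r.+2 = (p.+1 + q)%N) i
    (f : O p) (g : O q) : (1 <= i <= p)%N ->
  circ er' i.+1 (mu2 f) g = mu2 (circ er i f g).
Proof.
move=> /andP[i1 ip]; rewrite /mu2.
rewrite (circA_mid _ _ er (erefl : r.+2 = (2 + r)%N)) //; try lia.
by have -> : (i.+1 - 2 + 1)%N = i by lia.
Qed.

(** Associativity of [mu] turns cup products into compositions in the operad, which gives
    [cap_cap]. *)
Lemma mu2_cup p q (f : O p) (g : O q)
    (er : (p + q).+2 = (p.+1 + q.+1)%N) :
  mu2 (cup f g) = circ er 1 (mu2 f) (mu2 g).
Proof.
have er1 : p.+3 = (p.+1 + 2)%N by lia.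
have er2 : (p + q).+2 = (p.+2 + q)%N by lia.
have er3 : p.+3 = (2 + p.+1)%N by [].
rewrite {3}/mu2 -(circA_mid er1 er2 _ _ (j := 2)) // (mu2_circ_mu1 _ er3).
by rewrite (circA_mid _ _ (erefl : (p + q).+1 = (p.+1 + q)%N)
                          (erefl : (p + q).+2 = (2 + (p + q))%N)) // addn2.
Qed.

(** The signs are arranged so that, after applying [mu2], the last two terms form a single
    alternating sum over the slots [1] to [p.+1] of [mu2 f]. *)
Lemma deltaE p (er : p.+2 = (p + 2)%N) (f : O p) :
  delta f = circ (erefl : p.+2 = (2 + p)%N) 1 (mu O) f
    - (-1) ^+ p *: mu2 f
    - (-1) ^+ p *: \sum_(0 <= i < p) (-1) ^+ i.+1 *: circ er i.+1 f (mu O).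
Proof.
rewrite /delta /bracket (eq_irrelevance (etrans _ _) er) /circbar.
rewrite big_nat_recr //= big_nat1 muln0 expr0 scale1r muln1 -/(mu2 f).
(* The 3 is [q.+1] for [q = 2], standing for [q - 1 = 1]. *)
have signM3 i : (-1) ^+ (3 * i) = (-1) ^+ i :> k.
  by rewrite -signr_odd oddM signr_odd.
rewrite signM3 exprS mulN1r !scaleNr big_add1 /= opprK.
congr (_ + _); rewrite -scalerN -sumrN; congr (_ *: _); apply: eq_bigr => i _.
by rewrite subn1 signM3 exprS mulN1r scaleNr opprK.
Qed.

End OperadIdentities.

Section ChainIdentities.
Variables (k : comPzRingType) (O : mult_operad k) (M : cyclic_comp_module O).

Lemma cap_bilinear p n m (e : (m + p)%N = n) :
  kbilinear (@cap k O M p n m e).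
Proof.
split=> [x a f g|f]; last exact: (bul_bilinear _ _ _).2.
by rewrite /cap mu2_linear ((bul_bilinear M (cap_arity e) 0).1 x).
Qed.

(** The index [n.+1] is the wrap-around face; including it makes the boundary one alternating
    sum. *)
Definition face n i (x : M n.+1) : M n :=
  if (i <= n)%N then bul (addn2 n) i (mu O) x
  else bul (addn2 n) 0 (mu O) (cyc M n.+1 x).

Lemma face_linear n i : linear (@face n i).
Proof.
move=> a x y; rewrite /face; case: ifP => _.
  exact: (bul_bilinear M (addn2 n) i).2.
by rewrite linearP; apply: (bul_bilinear M (addn2 n) 0).2.
Qed.

Lemma bdryE n (x : M n.+1) :
  bdry x = \sum_(0 <= i < n.+2) (-1) ^+ i *: face i x.
Proof.
rewrite big_nat_recr //= {2}/face ltnn; congr (_ + _).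
by rewrite !big_nat; apply: eq_bigr => i; rewrite /face ltnS /= => ->.
Qed.

Lemma bdry_linear n : linear (@bdry k O M n).
Proof.
move=> a x y; rewrite !bdryE scaler_sumr -big_split /=; apply: eq_bigr => i _.
by rewrite face_linear scalerDr !scalerA mulrC.
Qed.

Lemma mu_bul_assoc n i (x : M n.+2) : (i <= n)%N ->
  bul (addn2 n) i (mu O) (bul (addn2 n.+1) i.+1 (mu O) x)
  = bul (addn2 n) i (mu O) (bul (addn2 n.+1) i (mu O) x).
Proof.
move=> ni; have e : (n + 3)%N = n.+3 by rewrite addn3.
rewrite !(bul_mid _ _ (erefl : 4%N = (2 + 2)%N) e) //; try lia.
by rewrite subnn subSnn muA.
Qed.

(* [cyc_bul] stops one index short of this case. Going around the other way,
   [bul n x] is [t ^ n] of [bul 0 y] with [x = t ^ n y], and [t ^ n+1 = 1]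
   on [M n] while [t ^ n+2 = 1] on [M n.+1]. *)
Lemma cyc_bul_last n (x : M n.+1) :
  cyc M n (bul (addn2 n) n (mu O) x)
  = bul (addn2 n) 0 (mu O) (cyc M n.+1 (cyc M n.+1 x)).
Proof.
set y := cyc M n.+1 _.
have iter_cyc j : (j <= n)%N -> iter j (cyc M n) (bul (addn2 n) 0 (mu O) y)
    = bul (addn2 n) j (mu O) (iter j (cyc M n.+1) y).
  elim: j => //= j IHj jn; rewrite IHj ?cyc_bul //; lia.
have -> : x = iter n (cyc M n.+1) y by rewrite -iterSr -iterSr cyc_order.
by rewrite -iter_cyc // -iterS cyc_order.
Qed.

Lemma face_face n i j (x : M n.+2) : (i < j)%N -> (j <= n.+2)%N ->
  face i (face j x) = face j.-1 (face i x).
Proof.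
case: j => // j; rewrite !ltnS => ij jn /=.
rewrite /face; have -> : (i <= n.+1)%N by lia.
have [jn1|jn1] := leqP j.+1 n.+1.
  have -> : (i <= n)%N by lia. have -> : (j <= n)%N by lia.
  have [->|ij'] := eqVneq i j; first by apply: mu_bul_assoc; lia.
  rewrite (bul_ge _ _ (addn2 n.+1) (addn2 n)) //; try lia.
  by congr (bul _ _ _ _); lia.
have -> : j = n.+1 by lia.
(* The outer index is now the wrap-around face. The case [i = n.+1] needs [t] of the last product,
   which [cyc_bul_last] supplies. *)
rewrite ltnn; have [ni|ni] := leqP i n; last first.
  have -> : i = n.+1 by lia.
  by rewrite cyc_bul_last cyc_bul // mu_bul_assoc.
rewrite cyc_bul; last lia.
have [->|i0] := posnP i; first by rewrite mu_bul_assoc.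
rewrite (bul_lt _ _ (addn2 n.+1) (addn2 n)) //.
by congr (bul _ _ _ (bul _ _ _ _)); lia.
Qed.

Lemma bdry_bdry n (x : M n.+2) : bdry (bdry x) = 0.
Proof.
rewrite bdryE -[RHS](@alternating_double_sum _ _
  (fun i j => face i (face j x)) n.+2) => [|i j]; last exact: face_face.
apply: eq_bigr => i _; congr (_ *: _).
have [g gE] := linear_packP (@face_linear n i).
by rewrite bdryE gE linear_sum; apply: eq_bigr => j _; rewrite linearZ.
Qed.

Lemma cap_cap p q n a m (ea : (a + q)%N = n) (em : (m + p)%N = a)
    (epq : (m + (p + q))%N = n) (f : O p) (g : O q) (x : M n) :
  cap em f (cap ea g x) = cap epq (cup f g) x.
Proof.
have er : (p + q).+2 = (p.+1 + q.+1)%N by rewrite addnS.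
rewrite /cap (mu2_cup _ _ er).
by rewrite (bul_mid _ _ er (cap_arity epq)).
Qed.

Lemma bdry_cap p n m (e : (m.+1 + p)%N = n.+1) (e' : (m + p)%N = n)
    (e1 : (m + p.+1)%N = n.+1) (f : O p) (x : M n.+1) :
  bdry (cap e f x) - (-1) ^+ p *: cap e' f (bdry x) = cap e1 (delta f) x.
Proof.
have em : (m + p.+2)%N = n.+2 by rewrite -e' !addnS.
have er2 : p.+3 = (2 + p.+1)%N by [].
have er1 : p.+3 = (p.+1 + 2)%N by rewrite addn2.
have er : p.+2 = (p + 2)%N by rewrite addn2.
have bul_cap0 : bul (addn2 m) 0 (mu O) (cap e f x)
    = bul em 0 (circ er2 1 (mu O) (mu2 f)) x.
  by rewrite /cap (bul_mid _ _ er2 em).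
(* Products beyond the inputs consumed by [f] commute with the cap; the index shift by [p] accounts
   for the sign in the commutator. *)
have bul_capS i : (i < m)%N -> bul (addn2 m) i.+1 (mu O) (cap e f x)
    = cap e' f (bul (addn2 n) (i.+1 + p) (mu O) x).
  move=> im; rewrite /cap (bul_lt _ _ (addn2 n) (cap_arity e')) //; try lia.
  by congr (bul _ _ _ (bul _ _ _ _)); lia.
have cap_bul i : (i <= p)%N -> cap e' f (bul (addn2 n) i (mu O) x)
    = bul em 0 (circ er1 i.+1 (mu2 f) (mu O)) x.
  move=> ip; rewrite /cap (bul_mid _ _ er1 em) //; try lia.
  by rewrite subn0 addn1.
(* The rotation moves [mu2 f] to position 1, into the second slot of [mu]; [mu2_circ_mu1] brings it
   back to position 0. *)
have cyc_cap : bul (addn2 m) 0 (mu O) (cyc M m.+1 (cap e f x))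
    = cap e' f (bul (addn2 n) 0 (mu O) (cyc M n.+1 x)).
  rewrite /cap cyc_bul; last lia.
  rewrite (bul_mid _ _ er2 em) // (bul_mid _ _ er1 em) //.
  by rewrite (mu2_circ_mu1 _ er2).
have cap_bdry : cap e' f (bdry x)
    = \sum_(0 <= i < n.+1) (-1) ^+ i *: cap e' f (bul (addn2 n) i (mu O) x)
      + (-1) ^+ n.+1 *: cap e' f (bul (addn2 n) 0 (mu O) (cyc M n.+1 x)).
  have [g ->] := linear_packP ((cap_bilinear e').2 f).
  rewrite linearD linearZ linear_sum; congr (_ + _).
  by apply: eq_bigr => i _; rewrite linearZ.
have cap_delta : cap e1 (delta f) x = bul (addn2 m) 0 (mu O) (cap e f x)
    - (-1) ^+ p *: \sum_(0 <= i < p.+1)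
        (-1) ^+ i *: cap e' f (bul (addn2 n) i (mu O) x).
  (* The split-off term [i = 0] comes from the summand [mu2 f] of [delta f], the others from the
     insertions of [mu] into [f]. *)
  rewrite (deltaE er) big_nat_recl // expr0 scale1r scalerDr opprD addrA.
  have [g gE] := linear_packP ((cap_bilinear e1).1 x).
  have {}gE h : g h = bul em 0 (mu2 h) x.
    by rewrite -gE /cap (eq_irrelevance (cap_arity e1) em).
  have -> h : cap e1 h x = g h.
    by rewrite gE /cap (eq_irrelevance (cap_arity e1) em).
  rewrite !linearB !linearZ linear_sum /= !gE.
  rewrite bul_cap0 cap_bul // (mu2_circ_mu1 _ er2) mu_circ1_mu2.
  rewrite (eq_irrelevance er2 erefl) -/(mu2 (mu2 f)).
  congr (_ + _ *: - _); rewrite !big_nat; apply: eq_bigr => i /andP[_ ip].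
  by rewrite linearZ /= gE cap_bul // (mu2_circ er).
rewrite cap_bdry cap_delta {cap_bdry cap_delta cap_bul}.
rewrite /bdry big_nat_recl // expr0 scale1r cyc_cap -!addrA; congr (_ + _).
(* The indices up to [p] are those in [cap_delta]; the rest cancel against the positive-index terms
   of the boundary of the cap. *)
rewrite (@big_cat_nat _ _ _ p.+1 0 n.+1) //=; last by rewrite -e'; lia.
set last_face := cap e' f (bul _ 0 _ (cyc _ _ _)).
have -> : \sum_(p.+1 <= i < n.+1)
      (-1) ^+ i *: cap e' f (bul (addn2 n) i (mu O) x)
    = (-1) ^+ p *: \sum_(0 <= i < m)
        (-1) ^+ i.+1 *: bul (addn2 m) i.+1 (mu O) (cap e f x).
  rewrite -{1}[p.+1]add0n big_addn; have -> : (n.+1 - p.+1 = m)%N by lia.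
  rewrite scaler_sumr !big_nat; apply: eq_bigr => i /andP[_ im].
  by rewrite bul_capS // scalerA -exprD addnS -addSn addnC.
have -> : (-1) ^+ n.+1 = (-1) ^+ p * (-1) ^+ m.+1 :> k.
  by rewrite -exprD addnS -e' addnC.
rewrite -addrA -scalerA !scalerDr !signrZK.
by rewrite addrA opprD addrC subrK.
Qed.

End ChainIdentities.

Theorem proposition1p2 (k : comPzRingType) (O : mult_operad k)
    (M : cyclic_comp_module O) :
  left_dg_module (@delta k O) (@cup k O) (@bdry k O M) (@cap k O M).
Proof.
split.
- exact: bdry_linear.
- exact: bdry_bdry.
- exact: cap_bilinear.
- exact: cap_cap.
- exact: bdry_cap.
Qed.
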